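(* Let $\omega\in\mathbb{R}$, $T>0$, and let $u=u(t,x)$ be a solution, defined on $[0,T)\times\mathbb{R}$, of the DGH equation with $\gamma=-2\omega$, i.e. of $$u_t+(u+2\omega)u_x=-\partial_x\Lambda^{-2}\left(u^2+\frac{u_x^2}{2}\right).$$ Assume that: (i) the quantity $\int_{\mathbb{R}}\left[u(t,x)^2+u_x(t,x)^2\right]dx$ is conserved (independent of $t\in[0,T)$); (ii) for each fixed $t$, $\partial_x\Lambda^{-2}\left(u^2+u_x^2/2\right)(t,\cdot)\in C^1(\mathbb{R})$; (iii) there exist numbers $t_0,t_1,x_0,x_1$ with $0<t_0<t_1<T$ and $x_0<x_1$ such that $u(t,x)=0$ for all $(t,x)\in(t_0,t_1)\times(x_0,x_1)$. Then $u\equiv 0$.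
   Context: $\Lambda^{2}=1-\partial_x^2$, with inverse $\Lambda^{-2}f=g\ast f$, where $g(x)=e^{-|x|}/2$ on $\mathbb{R}$. The DGH (Dullin-Gottwald-Holm) equation is $u_t-u_{txx}+2\omega u_x+3uu_x+\gamma u_{xxx}=2u_xu_{xx}+uu_{xxx}$; for $\gamma=-2\omega$ it is rewritten in the non-local form given in the claim. *)

(* Defs.v *)
From HB Require Import structures.
From mathcomp Require Import all_boot all_order all_algebra.
From mathcomp Require Import all_classical all_reals all_analysis.

Set Implicit Arguments.
Unset Strict Implicit.
Unset Printing Implicit Defensive.

Import Order.TTheory GRing.Theory Num.Theory.
Import numFieldNormedType.Exports.

Local Open Scope classical_set_scope.
Local Open Scope ring_scope.

Section TestFunctions.
Context {R : realType} {V : normedModType R}.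

(* All iterated directional derivatives exist and are differentiable; for
   finite-dimensional V this is the class C^oo. *)
Definition smooth (phi : V -> R^o) : Prop :=
  forall (s : seq V) (p : V),
    differentiable (foldr (fun v (f : V -> R^o) => 'D_v f) phi s) p.

Definition test_function (Omega : set V) (phi : V -> R^o) : Prop :=
  [/\ smooth phi, compact (closure [set p | phi p != 0])
    & closure [set p | phi p != 0] `<=` Omega].

End TestFunctions.

Section DGH.
Context {R : realType}.
Local Notation mu := (@lebesgue_measure R).
Implicit Types (f df : R -> R) (u ux : R -> R -> R).

Definition weak_derivative f df : Prop :=
  forall phi : R^o -> R^o, test_function setT phi ->
    \int[mu]_x (f x * derive1 phi x) = - \int[mu]_x (df x * phi x).

(* f is the continuous representative of an element of H^1(R) and df
   represents its distributional derivative. *)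
Definition H1_function f df : Prop :=
  [/\ continuous f, f \in Lfun mu 2%:E, df \in Lfun mu 2%:E
    & weak_derivative f df].

Definition green (x : R) : R := expR (- `|x|) / 2.

Definition Lambda_inv2 f (x : R) : R := \int[mu]_y (green (x - y) * f y).

Definition C1 f : Prop := (forall x : R, derivable f x 1) /\ continuous (derive1 f).

(* The function d_x Lambda^-2 (u^2 + u_x^2 / 2) (t, x). The density is
   integrable in x when u(t, .) is in H^1(R), and then Lambda_inv2 of it is
   everywhere differentiable, so that the derivative is a classical one. *)
Definition nonlocal u ux (t : R) : R -> R :=
  derive1 (Lambda_inv2 (fun y => u t y ^+ 2 + ux t y ^+ 2 / 2)).

Definition energy u ux (t : R) : R :=
  \int[mu]_x (u t x ^+ 2 + ux t x ^+ 2).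

(* Solutions of  u_t + (u + 2 omega) u_x = - d_x Lambda^-2 (u^2 + u_x^2 / 2)
   on [0, T) x R: u(t, .) is in H^1(R) for each t, with derivative ux(t, .),
   and the equation holds in the sense of distributions on (0, T) x R, i.e.
   after multiplication by phi and integration by parts in the term u_t.
   When the energy is bounded in t, as it is when conserved, all the integrands
   of the last clause are integrable. Points of R * R are the pairs (t, x). *)
Record solution (omega T : R) u ux : Prop := {
  solution_measurable :
    measurable_fun (`]0, T[ `*` setT) (fun p : R * R => u p.1 p.2) ;
  solution_dx_measurable :
    measurable_fun (`]0, T[ `*` setT) (fun p : R * R => ux p.1 p.2) ;
  solution_H1 : forall t, 0 <= t < T -> H1_function (u t) (ux t) ;
  solution_eq : forall phi : R^o * R^o -> R^o,
    test_function (`]0, T[ `*` setT) phi ->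
    \int[(mu \x mu)%E]_(p in `]0, T[ `*` setT)
      (- (u p.1 p.2 * 'D_(1, 0) phi p)
       + (u p.1 p.2 + 2 * omega) * ux p.1 p.2 * phi p)
    = \int[(mu \x mu)%E]_(p in `]0, T[ `*` setT)
      (- nonlocal u ux p.1 p.2 * phi p) }.

End DGH.

(* Main.v *)
(** Where u vanishes, so does its weak derivative u_x, and the equation then
    says that the non-local term d_x (g * F), with F = u^2 + u_x^2/2, vanishes
    there as a distribution. At a time t of the rectangle F vanishes a.e. on
    (x0, x1), so for x in that interval
      (g * F)(x) = e^-x A(t) + e^x B(t),
    where A(t), B(t) >= 0 are exponential moments of F on the left and on the
    right of the interval. Testing the equation against a(t) b'(x), with bumps
    a and b, and integrating by parts in x, gives
      int a(t) (p A(t) + q B(t)) dt = 0  with  p, q > 0,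
    hence A(t) = B(t) = 0 for some t. For this t, (g * F)(x) = 0, and as g > 0
    and F >= 0, F = 0 a.e. So the energy is zero at time t, hence at all times. *)
Require Import Defs.
From mathcomp Require Import all_boot all_order all_algebra.
From mathcomp Require Import all_classical all_reals all_analysis.
From mathcomp Require Import measurable_realfun ring lra.

Import Order.TTheory GRing.Theory Num.Theory.
Import numFieldNormedType.Exports.

Local Open Scope classical_set_scope.
Local Open Scope ring_scope.

(** * Smooth functions and test functions *)

Section Smooth.
Context {R : realType} {V : normedModType R}.
Implicit Types f g : V -> R^o.

(** Smoothness up to a finite order. Bounding the order allows an induction in which the product
    rule leaves factors of lower order. *)
Fixpoint n_smooth (n : nat) f : Prop :=
  (forall p, differentiable f p) /\
  if n is m.+1 then forall v, n_smooth m ('D_v f) else True.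

Lemma n_smooth_differentiable n f : n_smooth n f -> forall p, differentiable f p.
Proof. by case: n => [|n] []. Qed.

(** In [foldr] the last direction of the list is differentiated first, as in [n_smooth]; hence
    [rcons] and an induction from the end of the list. *)
Lemma smoothP f : smooth f <-> forall n, n_smooth n f.
Proof.
split=> [sf n|sf s].
  elim: n f sf => [|n IH] f sf; first by split=> // p; exact: sf [::] p.
  split=> [p|v]; first exact: sf [::] p.
  by apply: IH => s p; have := sf (rcons s v) p; rewrite foldr_rcons.
elim/last_ind: s f sf => [|s v IH] f sf p.
  exact: n_smooth_differentiable (sf 0%N) p.
rewrite foldr_rcons; apply: IH => n; exact: (sf n.+1).2.
Qed.

Lemma n_smoothW n f : n_smooth n.+1 f -> n_smooth n f.
Proof.
elim: n f => [|n IH] f [df sf]; split=> // v.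
by apply: IH; exact: sf.
Qed.

Lemma n_smoothD n f g : n_smooth n f -> n_smooth n g -> n_smooth n (f + g).
Proof.
elim: n f g => [|n IH] f g [df sf] [dg sg]; (split=> [p|]; first exact: differentiableD) => //.
move=> v; rewrite (_ : 'D_v (f + g) = 'D_v f + 'D_v g); first exact: IH (sf v) (sg v).
by apply/funext => p; rewrite deriveD//; exact: diff_derivable.
Qed.

Lemma n_smoothM n f g : n_smooth n f -> n_smooth n g -> n_smooth n (f * g).
Proof.
elim: n f g => [|n IH] f g sf sg.
  by case: sf => df _; case: sg => dg _; split=> // p; exact: differentiableM.
have [df f'] := sf; have [dg g'] := sg.
split=> [p|v]; first exact: differentiableM.
rewrite (_ : 'D_v (f * g) = f * 'D_v g + g * 'D_v f).
  apply: n_smoothD; apply: IH.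
  - exact: n_smoothW sf.
  - exact: g' v.
  - exact: n_smoothW sg.
  - exact: f' v.
by apply/funext => p; rewrite deriveM//; exact: diff_derivable.
Qed.

Lemma n_smooth_cst n (c : R^o) : n_smooth n (cst c : V -> R^o).
Proof.
elim: n c => [|n IH] c; split=> // v.
rewrite (_ : 'D_v _ = cst 0); first exact: IH.
by apply/funext => p; rewrite derive_cst.
Qed.

Lemma smoothM f g : smooth f -> smooth g -> smooth (f * g).
Proof. by move=> /smoothP sf /smoothP sg; apply/smoothP => n; exact: n_smoothM. Qed.

Lemma smooth_derive f v : smooth f -> smooth ('D_v f).
Proof. by move=> /smoothP sf; apply/smoothP => n; exact: (sf n.+1).2. Qed.

Lemma smooth_differentiable f p : smooth f -> differentiable f p.
Proof. by move=> sf; exact: sf [::] p. Qed.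

Lemma smooth_continuous f : smooth f -> continuous f.
Proof. by move=> sf p; apply/differentiable_continuous/smooth_differentiable. Qed.

End Smooth.

(** * Functions flat at the origin *)

Section FlatFunctions.
Context {R : realType}.
Implicit Types (q : {poly R}) (x : R).

(* The polynomial factor in 1/x makes this family stable under derivation. *)
Definition flat q x : R := if 0 < x then q.[x^-1] * expR (- x^-1) else 0.

(** Each monomial satisfies y^i <= i! e^y for y >= 0, by the exponential series; summing gives the
    constant. *)
Lemma poly_le_expR q : exists2 C, 0 <= C & forall y, 0 <= y -> `|q.[y]| <= C * expR y.
Proof.
exists (\sum_(i < size q) `|q`_i| * i`!%:R).
  by apply: sumr_ge0 => i _; rewrite mulr_ge0.
move=> y y0; rewrite horner_coef mulr_suml (le_trans (ler_norm_sum _ _ _))//.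
apply: ler_sum => i _; rewrite normrM -mulrA ler_wpM2l// normrX (ger0_norm y0).
rewrite -ler_pdivrMl ?ltr0n ?fact_gt0// mulrC.
case: (nat_of_ord i) => [|n]; first by rewrite expr0 fact0 divr1 -expR0 ler_expR.
by rewrite (le_trans _ (expR_ge1Dxn n y0))// lerDr.
Qed.

(** The exponential also absorbs one more power of 1/x: the bound for X q at 1/x leaves a factor x
    on the right. *)
Lemma flat_le q : exists2 C, 0 <= C & forall x, `|flat q x| <= C * `|x|.
Proof.
have [C C0 qC] := poly_le_expR ('X * q); exists C => // x.
rewrite /flat; case: ifPn => [x0|_]; last by rewrite normr0 mulr_ge0.
have := qC x^-1; rewrite invr_ge0 ltW// => /(_ isT).
rewrite hornerM hornerX !normrM (gtr0_norm (expR_gt0 _)) normfV (gtr0_norm x0).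
by rewrite expRN ler_pdivrMr ?expR_gt0// ler_pdivrMl// mulrA (mulrC x).
Qed.

(** For x > 0, the derivative of q(1/x) e^(-1/x) is x^-2 (q - q')(1/x) e^(-1/x), again of the same
    family. For x < 0 the function is locally zero. *)
Lemma is_derive_flat q x : is_derive x 1 (flat q) (flat ('X^2 * (q - q^`())) x).
Proof.
have [x0|x0|->] := ltrgt0P x.
- apply: (@near_eq_is_derive _ _ _ (fun y : R => q.[y^-1] * expR (- y^-1) : R)).
    near=> y; rewrite /flat; case: ifPn => // /negP; case.
    by near: y; exact: lt_nbhsr.
  have x_neq0 : x != 0 by rewrite gt_eqF.
  have dV : is_derive x 1 (fun y : R => y^-1) (- x ^- 2).
    by apply: is_derive_eq; [exact: is_deriveV | rewrite /= scaler1].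
  have dE : is_derive x 1 (fun y : R => expR (- y^-1)) (x ^- 2 * expR (- x^-1)).
    have dN : is_derive x 1 (fun y : R => - y^-1) (- - x ^- 2) by exact: is_deriveN.
    apply: (is_derive_eq (is_derive1_comp (is_derive_expR _) dN)).
    by rewrite opprK mulrC.
  have dq : is_derive (x^-1) 1 (horner q) (q^`()).[x^-1].
    apply: DeriveDef; first exact: derivable_horner.
    by rewrite -derive1E -derivE.
  have dqV : is_derive x 1 (fun y : R => q.[y^-1]) (q^`().[x^-1] * - x ^- 2).
    exact: (is_derive1_comp dq dV).
  apply: (is_derive_eq (is_deriveM dqV dE)).
  by rewrite /flat x0 !hornerE /= /GRing.scale/=; field.
- apply: (@near_eq_is_derive _ _ _ (cst 0 : R -> R)).
    near=> y; rewrite /flat; case: ifPn => //.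
    have : y < 0 by near: y; exact: lt_nbhsl.
    by move=> y0; rewrite lt_gtF.
  by apply: is_derive_eq; rewrite /flat lt_gtF.
(* At the origin the difference quotient of [flat q] is the flat function of X q, which is O(h). *)
- have [C C0 qC] := flat_le ('X * q).
  have lim0 : (fun h => h^-1 *: ((flat q \o shift 0) (h *: 1) - flat q 0))
      @ (0 : R)^' --> (0 : R).
    rewrite (_ : (fun h => _) = flat ('X * q)).
      suff : flat ('X * q) x @[x --> (0 : R)] --> (0 : R) by exact: cvg_within_filter.
      apply/cvgr0Pnorm_le => e e0; near=> h.
      (* The constant C may be 0; C + 1 can be divided by. *)
      rewrite (le_trans (qC h))// (@le_trans _ _ ((C + 1) * `|h|))//.
        by rewrite ler_wpM2r// lerDl.
      rewrite -ler_pdivlMl ?ltr_wpDl//; near: h.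
      have : 0 < (C + 1)^-1 * e by rewrite mulr_gt0// invr_gt0 ltr_wpDl.
      exact: (@nbhs0_le R R).
    apply/funext => h; rewrite /flat /= ltxx subr0 addr0 /GRing.scale/= mulr1.
    by case: ifP => h0; rewrite ?mulr0// hornerM hornerX mulrA.
  rewrite [flat _ 0]/flat ltxx; apply: DeriveDef; last exact: cvg_lim.
  by apply/cvg_ex; exists 0.
Unshelve. all: by end_near. Qed.

(** The hypotheses say that [l] is affine. By the chain rule a directional derivative is then a
    constant times a flat function of [l], with another polynomial, so the induction is over all
    [q]. *)
Lemma n_smooth_flat_comp {V : normedModType R} n q (l : V -> R^o) :
  (forall p, differentiable l p) -> (forall v, exists c, forall p, 'D_v l p = c) ->
  n_smooth n ((flat q : R^o -> R^o) \o l : V -> R^o).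
Proof.
move=> dl lc.
have dq q' y : differentiable (flat q' : R^o -> R^o) y.
  by apply/derivable1_diffP; case: (is_derive_flat q' y).
elim: n q => [|n IH] q; split=> //; try by move=> p; exact: differentiable_comp.
move=> v; have [c lvc] := lc v.
rewrite (_ : 'D_v _ = cst c * (flat ('X^2 * (q - q^`())) \o l : V -> R^o)).
  by apply: n_smoothM; [exact: n_smooth_cst | exact: IH].
apply/funext => p; rewrite deriveE; last exact: differentiable_comp.
rewrite diff_comp//= -(deriveE v (dl p)) lvc /=.
(* Linearity of the differential takes c out and leaves the ordinary derivative. *)
have -> : c = c *: (1 : R^o) by rewrite /GRing.scale/= mulr1.
rewrite [LHS]linearZ -deriveE// /GRing.scale/= mulr1.
by have [_ ->] := is_derive_flat q (l p).
Qed.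

End FlatFunctions.

Lemma smooth_flat_comp {R : realType} {V : normedModType R} q
    (k : {linear V -> R^o}) (a b : R) : continuous k ->
  smooth ((fun p => flat q (a + b * k p)) : V -> R^o).
Proof.
move=> ck; apply/smoothP => n.
pose l : V -> R^o := cst a + b *: (k : V -> R^o).
have dk p : differentiable k p by exact: linear_differentiable.
have dbk p : differentiable (b *: (k : V -> R^o)) p by exact: differentiableZ.
apply: (@n_smooth_flat_comp R V n q l) => [p|v]; first exact: differentiableD.
exists (b *: k v) => p; rewrite /l deriveD; [|exact: derivable_cst|exact: diff_derivable].
rewrite derive_cst add0r deriveZ; last exact: diff_derivable.
by rewrite deriveE// diff_lin.
Qed.

(** * Supports of test functions *)

Section Support.
Context {R : realType} {V : normedModType R}.
Implicit Types (phi : V -> R^o) (O : set V).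

Lemma test_function_sub O O' phi : O `<=` O' -> test_function O phi -> test_function O' phi.
Proof. by move=> OO' [? ? /subset_trans]; split=> //; auto. Qed.

(** Off its closed support [phi] is zero in a neighbourhood, so its derivatives are zero there. *)
Lemma support_derive phi v :
  closure [set p | 'D_v phi p != 0] `<=` closure [set p | phi p != 0].
Proof.
rewrite [X in _ `<=` X](proj1 (closure_id _) (@closed_closure _ _)).
apply: closureS => p; apply: contraPP => /= np.
have : nbhs p (~` closure [set p | phi p != 0]).
  by apply: open_nbhs_nbhs; split=> //; exact/closed_openC/closed_closure.
move=> pU; apply/negP; rewrite negbK; apply/eqP.
rewrite (@near_eq_derive _ _ _ _ (cst 0)) ?derive_cst//.
near=> y; apply/eqP/negPn/negP => phiy.
suff : (~` closure [set p | phi p != 0]) y by apply; exact: subset_closure.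
by near: y.
Unshelve. all: by end_near. Qed.

Lemma test_function_derive O phi v : test_function O phi -> test_function O ('D_v phi).
Proof.
move=> [sphi cphi phiO]; split; first exact: smooth_derive.
  by apply: (subclosed_compact _ cphi); [exact: closed_closure|exact: support_derive].
by apply: subset_trans phiO; exact: support_derive.
Qed.

Lemma test_function_out O phi p : test_function O phi -> ~ O p -> phi p = 0.
Proof.
move=> [_ _ phiO] Op; apply/eqP/negPn/negP => phip.
by apply/Op/phiO; exact: subset_closure.
Qed.

Lemma test_function_support O K phi : smooth phi -> compact K -> closed K ->
  (forall p, ~ K p -> phi p = 0) -> K `<=` O -> test_function O phi.
Proof.
move=> sphi cK clK phiK KO.
have sK : closure [set p | phi p != 0] `<=` K.
  rewrite [X in _ `<=` X](proj1 (closure_id _) clK); apply: closureS => p /= phip.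
  by apply: contrapT => /phiK p0; rewrite p0 eqxx in phip.
split=> //; last exact: subset_trans KO.
by apply: (subclosed_compact _ cK) => //; exact: closed_closure.
Qed.

End Support.

(** * Bumps on the line and on the plane *)

Section Bump.
Context {R : realType}.
Implicit Types c r x : R.

(** Since [flat 1] is e^(-1/x) on x > 0 and 0 elsewhere, this is a smooth bump with values in
    [0, 1], positive exactly on (c - r, c + r) when r > 0. *)
Definition bumpf c r x : R := flat 1 (1 + (x - c) / r) * flat 1 (1 - (x - c) / r).

Lemma flat1_ge0 x : 0 <= flat 1 x.
Proof. by rewrite /flat; case: ifP => // _; rewrite hornerC mul1r expR_ge0. Qed.

Lemma flat1_le1 x : flat 1 x <= 1.
Proof.
rewrite /flat; case: ifP => // x0; rewrite hornerC mul1r -expR0 ler_expR oppr_le0.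
by rewrite invr_ge0 ltW.
Qed.

Lemma flat1_ge x : 1 / 2 <= x -> expR (- 2) <= flat 1 x.
Proof.
move=> x2; have x0 : 0 < x by lra.
rewrite /flat x0 hornerC mul1r ler_expR lerN2 -(invrK 2) lef_pV2 ?posrE; lra.
Qed.

Lemma bumpf_ge0 c r x : 0 <= bumpf c r x.
Proof. by rewrite mulr_ge0// flat1_ge0. Qed.

Lemma bumpf_le1 c r x : bumpf c r x <= 1.
Proof. by rewrite mulr_ile1 ?flat1_ge0 ?flat1_le1. Qed.

Lemma bumpf_gt0 c r x : 0 < r -> `|x - c| < r -> 0 < bumpf c r x.
Proof.
move=> r0; rewrite ltr_norml => /andP[x1 x2].
have h1 : -1 < (x - c) / r by rewrite ltr_pdivlMr// mulN1r.
have h2 : (x - c) / r < 1 by rewrite ltr_pdivrMr// mul1r.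
rewrite /bumpf /flat !ifT; [|lra|lra].
by rewrite !hornerC !mul1r mulr_gt0// expR_gt0.
Qed.

(** On the concentric interval of half the radius, both arguments of [flat 1] are at least 1/2, so
    each factor is at least e^-2. *)
Lemma bumpf_ge c r x : 0 < r -> `|x - c| <= r / 2 -> expR (- 2) ^+ 2 <= bumpf c r x.
Proof.
move=> r0; rewrite ler_norml => /andP[x1 x2].
have h1 : - (1/2) <= (x - c) / r by rewrite ler_pdivlMr//; lra.
have h2 : (x - c) / r <= 1/2 by rewrite ler_pdivrMr//; lra.
by rewrite expr2 ler_pM ?expR_ge0// flat1_ge//; lra.
Qed.

Lemma bumpf_eq0 c r x : 0 < r -> r <= `|x - c| -> bumpf c r x = 0.
Proof.
move=> r0; rewrite ler_normr => /orP[xr|xr].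
- have h1 : 1 <= (x - c) / r by rewrite ler_pdivlMr//; lra.
  by rewrite /bumpf {2}/flat ifF ?mulr0//; apply/negbTE; rewrite -leNgt; lra.
- have h1 : (x - c) / r <= -1 by rewrite ler_pdivrMr//; lra.
  by rewrite /bumpf {1}/flat ifF ?mul0r//; apply/negbTE; rewrite -leNgt; lra.
Qed.

Lemma bumpf_out c r x : 0 < r -> ~ `[c - r, c + r]%classic x -> bumpf c r x = 0.
Proof.
move=> r0 /negP; rewrite in_itv/= -ler_distl -ltNge => /ltW; exact: bumpf_eq0.
Qed.

(** The linear form [k] will be the identity of the line or a coordinate of the plane. *)
Lemma smooth_bumpf_comp {V : normedModType R} (k : {linear V -> R^o}) c r :
  continuous k -> smooth ((fun p => bumpf c r (k p)) : V -> R^o).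
Proof.
move=> ck.
rewrite (_ : (fun p => _) = ((fun p => flat 1 (1 - c / r + r^-1 * k p)) : V -> R^o)
   * ((fun p => flat 1 (1 + c / r + (- r^-1) * k p)) : V -> R^o)).
  by apply: smoothM; exact: smooth_flat_comp.
apply/funext => p; rewrite /bumpf; congr (flat _ _ * flat _ _); ring.
Qed.

Lemma smooth_bumpf c r : smooth (bumpf c r : R^o -> R^o).
Proof. by apply: (@smooth_bumpf_comp R^o idfun) => ?. Qed.

Lemma bumpf_test_function c r (O : set R^o) : 0 < r -> `[c - r, c + r]%classic `<=` O ->
  test_function O (bumpf c r : R^o -> R^o).
Proof.
move=> r0; apply: test_function_support; first exact: smooth_bumpf.
- exact: segment_compact.
- exact: interval_closed.
- by move=> p; exact: bumpf_out.
Qed.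

Definition bumpf2 c r c' r' : R^o * R^o -> R^o := fun p => bumpf c r p.1 * bumpf c' r' p.2.

Lemma bumpf2_test_function c r c' r' (O : set (R^o * R^o)) : 0 < r -> 0 < r' ->
  `[c - r, c + r] `*` `[c' - r', c' + r'] `<=` O ->
  test_function O (bumpf2 c r c' r').
Proof.
move=> r0 r'0; apply: test_function_support.
- apply: smoothM.
    by apply: (@smooth_bumpf_comp (R^o * R^o)%type fst) => ?; exact: cvg_fst.
  by apply: (@smooth_bumpf_comp (R^o * R^o)%type snd) => ?; exact: cvg_snd.
- by apply: compact_setX; exact: segment_compact.
- rewrite (_ : _ `*` _ = (fst @^-1` `[c - r, c + r]) `&` (snd @^-1` `[c' - r', c' + r']))//.
  apply: closedI; apply: preimage_closed; try exact: interval_closed; move=> ? _.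
    exact: cvg_fst.
  exact: cvg_snd.
- move=> p np; rewrite /bumpf2.
  have [p1|p1] := pselect (`[c - r, c + r]%classic p.1); last by rewrite bumpf_out ?mul0r.
  by rewrite (@bumpf_out c') ?mulr0// => p2; exact: np.
Qed.

(** Along (0, 1) the factor in the first variable is constant and comes out of the difference
    quotient. *)
Lemma derive_bumpf2 c r c' r' (p : R^o * R^o) :
  'D_(0, 1) (bumpf2 c r c' r') p = bumpf c r p.1 * derive1 (bumpf c' r') p.2.
Proof.
rewrite /derive1 /derive.
rewrite (_ : (fun h => _) = (fun h => bumpf c r p.1 *:
  (h^-1 *: (bumpf c' r' (h + p.2) - bumpf c' r' p.2)))); last first.
  apply/funext => h; rewrite /bumpf2 /= scaler0 add0r /GRing.scale/= mulr1; ring.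
apply: cvg_lim => //; apply: cvgZl_tmp.
have /derivable1_diffP := smooth_differentiable _ p.2 (smooth_bumpf c' r').
rewrite /derivable; under eq_fun do rewrite /= /GRing.scale/= mulr1.
by [].
Qed.

End Bump.

(** * Weak derivatives *)

Section IntegrationFacts.
Context d (T : measurableType d) (R : realType) (mu : {measure set T -> \bar R}).
Implicit Types (D : set T) (f g h : T -> R).

Lemma integrable_bounded_mul D f h (C : R) : measurable D ->
  measurable_fun D h -> (forall x, D x -> `|h x| <= C) ->
  mu.-integrable D (EFin \o f) -> mu.-integrable D (EFin \o (fun x => h x * f x)).
Proof.
move=> mD mh hC fi.
suff hb : [bounded h x | x in D] by exact: (integrableMr mD mh hb fi).
exists C; split; first exact: num_real.
by move=> M CM x Dx /=; rewrite (le_trans (hC _ Dx))// ltW.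
Qed.

Lemma ae_eq_Rintegral D f g : measurable D -> measurable_fun D f -> measurable_fun D g ->
  {ae mu, forall x, D x -> f x = g x} ->
  \int[mu]_(x in D) f x = \int[mu]_(x in D) g x.
Proof.
move=> mD mf mg fg; congr fine; apply: ae_eq_integral => //.
- exact/measurable_EFinP.
- exact/measurable_EFinP.
by move: fg; apply: filterS => x fg Dx /=; rewrite fg.
Qed.

Lemma Rintegral_eq0_ae D f : measurable D -> mu.-integrable D (EFin \o f) ->
  (forall x, D x -> 0 <= f x) -> \int[mu]_(x in D) f x = 0 ->
  {ae mu, forall x, D x -> f x = 0}.
Proof.
move=> mD fi f0 If.
have mf := measurable_int _ fi.
have /(ae_eq_integral_abs _ mD mf) : (\int[mu]_(x in D) `|(EFin \o f) x| = 0)%E.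
  rewrite -(_ : \int[mu]_(x in D) (f x)%:E = 0)%E.
    by apply: eq_integral => x /set_mem Dx /=; rewrite ger0_norm ?f0.
  by rewrite -[LHS]fineK ?[fine _]If//; exact: integrable_fin_num.
by apply: filterS => x fx Dx; have /= [] := fx Dx.
Qed.

Lemma Rintegral_subset D E f : measurable D -> measurable E -> D `<=` E ->
  (forall x, E x -> ~ D x -> f x = 0) ->
  \int[mu]_(x in E) f x = \int[mu]_(x in D) f x.
Proof.
move=> mD mE DE f0; rewrite -(setIidr DE) Rintegral_mkcondr.
apply: eq_Rintegral => x /set_mem Ex; rewrite /patch; case: ifPn => //.
by move/negP => nDx; apply: f0 => // Dx; apply: nDx; rewrite inE.
Qed.

End IntegrationFacts.

Section WeakDerivative.
Context {R : realType}.
Local Notation mu := (@lebesgue_measure R).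
Implicit Types (f df : R -> R) (x r : R).

Lemma measurable_bumpf c r D : measurable_fun D (bumpf c r).
Proof.
apply: measurable_funTS; apply: continuous_measurable_fun.
exact: smooth_continuous (smooth_bumpf c r).
Qed.

Lemma integrable_ball f x r : locally_integrable setT f ->
  mu.-integrable (ball x r) (EFin \o f).
Proof.
move=> [mf _ lf]; have mc : measurable `[x - r, x + r] by [].
apply: (@integrableS _ _ _ mu `[x - r, x + r]) => //.
- exact: measurable_ball.
- by rewrite ball_itv; apply: subset_itv; rewrite bnd_simp.
- apply/integrableP; split; first by apply/measurable_EFinP; exact: measurable_funTS.
  apply: lf => //; exact: segment_compact.
Qed.

(** With the bump as test function, the side containing [f] is zero because [f] vanishes on the
    support of the bump. *)
Lemma weak_derivative_bumpf f df x r : 0 < r -> weak_derivative f df ->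
  (forall y, x - r <= y <= x + r -> f y = 0) ->
  \int[mu]_(y in ball x r) (df y * bumpf x r y) = 0.
Proof.
move=> r0 wd f0.
have tf : test_function `[x - r, x + r] (bumpf x r : R^o -> R^o).
  exact: bumpf_test_function.
have := wd _ (test_function_sub _ _ _ (@subsetT _ _) tf).
rewrite (_ : (fun y => f y * _) = cst 0); last first.
  apply/funext => y /=; have [yx|yx] := pselect (`[x - r, x + r]%classic y).
    by rewrite f0 ?mul0r.
  rewrite derive1E (@test_function_out _ _ _ _ _ (test_function_derive _ _ (1 : R^o) tf) yx).
  by rewrite mulr0.
rewrite Rintegral_cst// mul0r => /eqP; rewrite eq_sym oppr_eq0 => /eqP <-.
apply/esym/Rintegral_subset => //; first exact: measurable_ball.
move=> y _; rewrite /ball/= => /negP; rewrite -leNgt distrC => xy.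
by rewrite bumpf_eq0 ?mulr0.
Qed.

(** The bump is at least (e^-2)^2 on the interval of radius r/2, whose length is r. *)
Lemma Rintegral_bumpf_ge x r : 0 < r ->
  expR (- 2) ^+ 2 * r <= \int[mu]_(y in ball x r) bumpf x r y.
Proof.
move=> r0; have mB : measurable (ball x r : set R) by exact: measurable_ball.
pose C : set R := `[x - r / 2, x + r / 2]%classic.
have mC : measurable C by exact: measurable_itv.
have CB : C `<=` ball x r.
  move=> y; rewrite /C/= in_itv/= -ler_distl /ball/= distrC => yr.
  by rewrite (le_lt_trans yr)// ltr_pdivrMr// ltr_pMr// ltr1n.
have bi : mu.-integrable (ball x r) (EFin \o bumpf x r).
  apply: measurable_bounded_integrable => //; last 2 first.
  - exact: measurable_bumpf.
  - exists 1; split; first exact: num_real.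
    by move=> M M1 y _ /=; rewrite ger0_norm ?bumpf_ge0// (le_trans (bumpf_le1 _ _ _))// ltW.
  by rewrite /= lebesgue_measure_ball ?ltry// ltW.
rewrite -lee_fin fineK; last exact: integrable_fin_num.
apply: (@le_trans _ _ (\int[mu]_(y in C) (bumpf x r y)%:E)%E); last first.
  apply: ge0_subset_integral => //; first exact: measurable_int bi.
  by move=> y _; rewrite lee_fin bumpf_ge0.
rewrite (_ : (_ * r)%:E = \int[mu]_(y in C) cst (expR (- 2) ^+ 2)%:E y)%E; last first.
  rewrite integral_cst//= lebesgue_measure_itv/= lte_fin ifT; last lra.
  rewrite -EFinB -EFinM; congr (_ * _)%:E; lra.
apply: ge0_le_integral => //.
- by move=> y _; rewrite lee_fin exprn_ge0// expR_ge0.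
- by apply/measurable_EFinP; exact: measurable_bumpf.
- move=> y; rewrite /C/= in_itv/= -ler_distl => yr.
  by rewrite lee_fin bumpf_ge.
Qed.

(* At a Lebesgue point x of df, testing against bumps that shrink to x gives
   df x = 0. *)
Lemma weak_derivative_eq0 f df a b : weak_derivative f df ->
  locally_integrable setT df -> (forall x, a < x < b -> f x = 0) ->
  {ae mu, forall x, a < x < b -> df x = 0}.
Proof.
move=> wd ldf f0.
apply: filterS; first exact: (ae_filter_ringOfSetsType mu).
  2: exact: lebesgue_differentiation ldf.
move=> x px /andP[ax xb].
pose m : R := expR (- 2) ^+ 2.
have m0 : 0 < m by rewrite exprn_gt0// expR_gt0.
(* As the integral of b df is 0 for the bump b, that of b (df - df x) is - df x times that of b.
   Hence |df x| m r is at most the integral of |df - df x| over the ball, and dividing by its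
   measure 2r leaves the factor m / 2. *)
have key : \forall r \near (0 : R)^'+, ((`|df x| * (m / 2))%:E <= davg df x r)%E.
  near=> r.
  have r0 : 0 < r by near: r; exact: nbhs_right_gt.
  have rax : r < x - a by near: r; apply: nbhs_right_lt; lra.
  have rxb : r < b - x by near: r; apply: nbhs_right_lt; lra.
  have mB : measurable (ball x r : set R) by exact: measurable_ball.
  have muB : (mu (ball x r) < +oo)%E by rewrite lebesgue_measure_ball ?ltry// ltW.
  have dfi := integrable_ball _ x r ldf.
  have mb := measurable_bumpf x r (ball x r).
  have b1 y : `|bumpf x r y| <= 1 by rewrite ger0_norm ?bumpf_ge0// bumpf_le1.
  have ci (c : R) : mu.-integrable (ball x r) (EFin \o (fun=> c)).
    apply: measurable_bounded_integrable => //.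
    by exists `|c|; split=> [|M cM y _ /=]; [exact: num_real|exact: ltW].
  have bi : mu.-integrable (ball x r) (EFin \o bumpf x r).
    have := integrable_bounded_mul _ _ _ mu (ball x r) (cst 1) (bumpf x r) 1 mB mb.
    move=> /(_ (fun y _ => b1 y) (ci 1)).
    by apply: eq_integrable => // y _; rewrite /= mulr1.
  have dfbi := integrable_bounded_mul _ _ _ mu _ df (bumpf x r) 1 mB mb (fun y _ => b1 y) dfi.
  have I0 : \int[mu]_(y in ball x r) (bumpf x r y * df y) = 0.
    have := weak_derivative_bumpf f df x r r0 wd.
    under eq_Rintegral do rewrite mulrC.
    by apply=> y /andP[y1 y2]; apply: f0; apply/andP; split; lra.
  have gi : mu.-integrable (ball x r) (EFin \o (fun y => df y - df x)).
    have := @integrableB _ _ _ mu _ mB _ _ dfi (ci (df x)).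
    by apply: eq_integrable => // y _.
  have gbi := integrable_bounded_mul _ _ _ mu _ _ (bumpf x r) 1 mB mb (fun y _ => b1 y) gi.
  have E1 : \int[mu]_(y in ball x r) (bumpf x r y * (df y - df x)) =
      - (df x * \int[mu]_(y in ball x r) bumpf x r y).
    rewrite -RintegralZl// -[RHS]add0r -{1}I0 -RintegralB//.
      by apply: eq_Rintegral => y _; rewrite mulrBr (mulrC (df x)).
    have := @integrableZl _ _ _ mu _ mB (df x) _ bi.
    by apply: eq_integrable => // y _.
  have E2 : `|df x| * (m * r) <= \int[mu]_(y in ball x r) `|df y - df x|.
    apply: (@le_trans _ _ `|\int[mu]_(y in ball x r) (bumpf x r y * (df y - df x))|).
      rewrite E1 normrN normrM ler_wpM2l//.
      by rewrite (le_trans _ (ler_norm _))// Rintegral_bumpf_ge.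
    apply: (le_trans (@le_normr_Rintegral _ _ _ mu _ _ mB gbi)); apply: le_Rintegral => //.
    - exact: integrable_norm gbi.
    - exact: integrable_norm gi.
    - by move=> y _; rewrite normrM ler_piMl.
  rewrite /davg /iavg (lebesgue_measure_ball _ (ltW r0)) inver mulrn_eq0/= gt_eqF//.
  have -> : (\int[mu]_(y in ball x r) `|((center (df x) \o df) y)%:E| =
             (\int[mu]_(y in ball x r) `|df y - df x|)%:E)%E.
    by rewrite fineK//; apply: integrable_fin_num => //; exact: integrable_norm gi.
  rewrite -EFinM lee_fin ler_pdivlMl ?mulrn_wgt0//.
  rewrite (le_trans _ E2)// (_ : r *+ 2 * _ = `|df x| * (m * r))//.
  by rewrite -mulr_natr; field.
have m2 : 0 < m / 2 by rewrite divr_gt0.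
(* At a Lebesgue point the mean deviation tends to 0 with r. *)
have := cvge_ge key px; rewrite lee_fin => h.
apply/eqP; rewrite -normr_le0 -(pmulr_lle0 _ m2); exact: h.
Unshelve. all: by end_near. Qed.

End WeakDerivative.

(** * Null sets and local integrability on the line *)

Section RealAnalysis.
Context {R : realType}.
Local Notation mu := (@lebesgue_measure R).
Implicit Types (f g df F : R -> R) (a b c r x : R).

(** A ball has positive measure, so it is not contained in a null set. *)
Lemma ae_exists (P : R -> Prop) c r : 0 < r -> {ae mu, forall x, P x} ->
  exists2 x, ball c r x & P x.
Proof.
move=> r0 [N [mN N0 PN]]; apply: contrapT => nP.
have bN : ball c r `<=` N.
  by move=> x cx; apply: PN => Px; apply: nP; exists x.
have : (mu (ball c r) <= mu N)%E.
  by apply: le_measure; rewrite ?inE//; exact: measurable_ball.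
by rewrite N0 /= (lebesgue_measure_ball _ (ltW r0)) lee_fin leNgt mulrn_wgt0.
Qed.

Lemma continuous_ae_eq0 f : continuous f -> {ae mu, forall x, f x = 0} ->
  forall x, f x = 0.
Proof.
move=> cf f0 x; apply/eqP/negPn/negP => fx.
have : \forall y \near x, f y != 0.
  exact: cvgr_neq0 (cf x) fx.
move=> /nbhs_ballP[r /= r0 rf].
have [y xy /eqP fy] := ae_exists _ x r r0 f0.
by have := rf y xy; rewrite fy.
Qed.

Lemma measurable_Lfun f p : f \in Lfun mu p -> measurable_fun setT f.
Proof. by rewrite inE => /andP[]; rewrite inE. Qed.

(** On a compact set, which has finite measure, |f| is dominated by the integrable function 1 +
    f^2. *)
Lemma Lfun2_locally_integrable f : f \in Lfun mu 2%:E -> locally_integrable setT f.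
Proof.
move=> f2; have mf := measurable_Lfun _ _ f2; split=> [//| |K _ cK]; first exact: openT.
have mK : measurable K by exact: compact_measurable.
have f2i := @integrableS _ _ _ mu _ K _ measurableT mK (@subsetT _ _)
  (Lfun2_integrable_sqr f2).
have i1 : mu.-integrable K (EFin \o (fun=> 1%R)).
  apply: measurable_bounded_integrable => //; first exact: compact_finite_measure.
  by exists 1; split=> [|M cM y _ /=]; [exact: num_real|rewrite normr1; exact: ltW].
have : mu.-integrable K (EFin \o f).
  apply: (@le_integrable _ _ _ mu _ mK _ _ _ _ (@integrableD _ _ _ mu _ mK _ _ i1 f2i)).
    by apply/measurable_EFinP; exact: measurable_funTS.
  move=> x _ /=; rewrite lee_fin [leRHS]ger0_norm ?addr_ge0// ?sqr_ge0//.
  rewrite -(real_normK (num_real (f x))).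
  have := sqr_ge0 (`|f x| - 1); have := normr_ge0 (f x); nra.
by case/integrableP.
Qed.

End RealAnalysis.

(** * Tensor products and Fubini's theorem *)

Section Tensor.
Context {R : realType}.
Local Notation mu := (@lebesgue_measure R).
Implicit Types (f g : R -> R).

Lemma measurable_tensor f g : measurable_fun setT f -> measurable_fun setT g ->
  measurable_fun setT (fun p : R * R => f p.1 * g p.2).
Proof.
move=> mf mg; apply: measurable_funM.
  exact: (measurableT_comp mf measurable_fst).
exact: (measurableT_comp mg measurable_snd).
Qed.

Lemma integrable_tensor f g : mu.-integrable setT (EFin \o f) ->
  mu.-integrable setT (EFin \o g) ->
  (mu \x mu)%E.-integrable setT (EFin \o (fun p : R * R => f p.1 * g p.2)).
Proof.
move=> /[dup] fi /integrableP[/measurable_EFinP mf foo].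
move=> /[dup] gi /integrableP[/measurable_EFinP mg goo].
apply/integrable12ltyP; first by apply/measurable_EFinP; exact: measurable_tensor.
have g_fin : (\int[mu]_y `|(EFin \o g) y|)%E \is a fin_num.
  by rewrite ge0_fin_numE// integral_ge0.
rewrite (_ : (\int[mu]_x _)%E =
  (\int[mu]_x (`|(EFin \o f) x| * (\int[mu]_y `|(EFin \o g) y|)))%E).
  rewrite ge0_integralZr//; last exact: integral_ge0.
    by rewrite lte_mul_pinfty// ?integral_ge0// ge0_fin_numE// integral_ge0.
  by apply: measurableT_comp => //; exact/measurable_EFinP.
apply: eq_integral => x _; rewrite -ge0_integralZl//; last first.
  by apply: measurableT_comp => //; exact/measurable_EFinP.
by apply: eq_integral => y _ /=; rewrite normrM EFinM.
Qed.

Lemma Rintegral_tensor f g : mu.-integrable setT (EFin \o f) ->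
  mu.-integrable setT (EFin \o g) ->
  \int[(mu \x mu)%E]_p (f p.1 * g p.2) = \int[mu]_x f x * \int[mu]_y g y.
Proof.
move=> fi gi; rewrite -RintegralZr//; congr fine.
have := integral12_prod_meas1 (integrable_tensor _ _ fi gi).
move=> <-; apply: eq_integral => x _; rewrite /fubini_F/=.
rewrite EFinM fineK; last exact: integrable_fin_num.
by rewrite -integralZl//; apply: eq_integral => y _; rewrite EFinM.
Qed.

(** Passes from properties that hold almost everywhere in x at each fixed time to properties almost
    everywhere in the plane. *)
Lemma null_xsection (Z : set (R * R)) : measurable Z ->
  (forall x, mu (xsection Z x) = 0%E) -> (mu \x mu)%E Z = 0%E.
Proof.
by move=> mZ Z0; rewrite /product_measure1; apply: integral0_eq => x _ /=.
Qed.

End Tensor.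

(** * Convolution with the Green function across a gap *)

Section GreenGap.
Context {R : realType}.
Local Notation mu := (@lebesgue_measure R).
Implicit Types (F : R -> R) (a b x y : R).

(** The y-factors of the Green function: e^(-(x-y))/2 = e^(-x) (e^y/2) for y <= x, and e^(x-y)/2 =
    e^x (e^(-y)/2) for y >= x. They are cut off at the ends of the gap, which makes them bounded. *)
Definition lweight a y : R := if y <= a then expR y / 2 else 0.
Definition rweight b y : R := if b <= y then expR (- y) / 2 else 0.

Lemma measurable_lweight a : measurable_fun setT (lweight a).
Proof.
apply: measurable_fun_ifT => //; first exact: measurable_fun_ler.
by apply: measurable_funM => //; exact: measurable_expR.
Qed.

Lemma measurable_rweight b : measurable_fun setT (rweight b).
Proof.
apply: measurable_fun_ifT => //; first exact: measurable_fun_ler.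
apply: measurable_funM => //; apply: measurableT_comp; first exact: measurable_expR.
exact: oppr_measurable.
Qed.

Lemma lweight_ge0 a y : 0 <= lweight a y.
Proof. by rewrite /lweight; case: ifP => // _; rewrite divr_ge0// expR_ge0. Qed.

Lemma rweight_ge0 b y : 0 <= rweight b y.
Proof. by rewrite /rweight; case: ifP => // _; rewrite divr_ge0// expR_ge0. Qed.

Lemma lweight_le a y : lweight a y <= expR a / 2.
Proof.
rewrite /lweight; case: ifP => [ya|_]; last by rewrite divr_ge0// expR_ge0.
by rewrite ler_wpM2r// ler_expR.
Qed.

Lemma rweight_le b y : rweight b y <= expR (- b) / 2.
Proof.
rewrite /rweight; case: ifP => [ya|_]; last by rewrite divr_ge0// expR_ge0.
by rewrite ler_wpM2r// ler_expR lerN2.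
Qed.

Lemma green_gt0 x : 0 < green x.
Proof. by rewrite divr_gt0// expR_gt0. Qed.

Lemma green_le x : green x <= 1 / 2.
Proof. by rewrite ler_wpM2r// -expR0 ler_expR oppr_le0. Qed.

Lemma measurable_green x : measurable_fun setT (fun y : R => green (x - y)).
Proof.
apply: measurable_funM => //; apply: measurableT_comp; first exact: measurable_expR.
apply: measurableT_comp; first exact: oppr_measurable.
by apply: measurableT_comp => //; exact: measurable_funB.
Qed.

(** When x is in the gap and y is not, the sign of x - y is known, and the exponential factors. *)
Lemma green_gap a b x y : a < x < b -> ~ (a < y < b) ->
  green (x - y) = expR (- x) * lweight a y + expR x * rweight b y.
Proof.
move=> /andP[ax xb] /negP; rewrite negb_and -!leNgt /green /lweight /rweight => /orP[ya|yb].
- rewrite ya ifF; last by apply/negbTE; rewrite -ltNge; lra.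
  rewrite mulr0 addr0 mulrA -expRD ger0_norm; last by lra.
  by congr (expR _ / 2); ring.
- rewrite yb ifF; last by apply/negbTE; rewrite -ltNge; lra.
  rewrite mulr0 add0r mulrA -expRD ler0_norm; last by lra.
  by congr (expR _ / 2); ring.
Qed.

Lemma integrable_weight (w : R -> R) F (C : R) : measurable_fun setT w ->
  (forall y, 0 <= w y <= C) -> mu.-integrable setT (EFin \o F) ->
  mu.-integrable setT (EFin \o (fun y => w y * F y)).
Proof.
move=> mw wC Fi; apply: (@integrable_bounded_mul _ _ _ mu _ F w C) => //.
by move=> y _; have /andP[w0 wy] := wC y; rewrite ger0_norm.
Qed.

Lemma integrable_lweight a F : mu.-integrable setT (EFin \o F) ->
  mu.-integrable setT (EFin \o (fun y => lweight a y * F y)).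
Proof.
apply: (integrable_weight _ _ (expR a / 2)) => [|y]; first exact: measurable_lweight.
by rewrite lweight_ge0 lweight_le.
Qed.

Lemma integrable_rweight b F : mu.-integrable setT (EFin \o F) ->
  mu.-integrable setT (EFin \o (fun y => rweight b y * F y)).
Proof.
apply: (integrable_weight _ _ (expR (- b) / 2)) => [|y]; first exact: measurable_rweight.
by rewrite rweight_ge0 rweight_le.
Qed.

Lemma integrable_green x F : mu.-integrable setT (EFin \o F) ->
  mu.-integrable setT (EFin \o (fun y => green (x - y) * F y)).
Proof.
apply: (integrable_weight _ _ (1 / 2)) => [|y]; first exact: measurable_green.
by rewrite ltW ?green_gt0// green_le.
Qed.

Lemma Lambda_inv2_gap F a b x : mu.-integrable setT (EFin \o F) ->
  {ae mu, forall y, a < y < b -> F y = 0} -> a < x < b ->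
  Lambda_inv2 F x = expR (- x) * \int[mu]_y (lweight a y * F y)
                  + expR x * \int[mu]_y (rweight b y * F y).
Proof.
move=> Fi F0 axb.
have li := integrable_lweight a _ Fi; have ri := integrable_rweight b _ Fi.
have mF : measurable_fun setT F by apply/measurable_EFinP; exact: measurable_int Fi.
rewrite -!RintegralZl// -RintegralD//; last 2 first.
- exact: (@integrableZl _ _ _ mu _ measurableT (expR (- x)) _ li).
- exact: (@integrableZl _ _ _ mu _ measurableT (expR x) _ ri).
apply: (@ae_eq_Rintegral _ _ _ mu) => //.
- by apply: measurable_funM => //; exact: measurable_green.
- apply: measurable_funD; apply: measurable_funM => //; apply: measurable_funM => //.
    exact: measurable_lweight.
  exact: measurable_rweight.
move: F0; apply: (@filterS _ _ (ae_filter_ringOfSetsType mu)).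
(* Inside the gap the kernels may differ, but both are multiplied by F y = 0. *)
move=> y F0 _; have [yab|yab] := pselect (a < y < b).
  by rewrite F0// !mulr0 addr0.
by rewrite (green_gap _ _ _ _ axb yab) mulrDl !mulrA.
Qed.

(** The gap formula holds in a neighbourhood of x with the same two integrals, so only e^(-x) and
    e^x are differentiated. *)
Lemma derive1_Lambda_inv2_gap F a b x : mu.-integrable setT (EFin \o F) ->
  {ae mu, forall y, a < y < b -> F y = 0} -> a < x < b ->
  derive1 (Lambda_inv2 F) x = - expR (- x) * \int[mu]_y (lweight a y * F y)
                  + expR x * \int[mu]_y (rweight b y * F y).
Proof.
move=> Fi F0 axb; set A := \int[mu]_y _; set B := \int[mu]_y (rweight _ _ * _).
rewrite derive1E (@near_eq_derive _ _ _ _ (fun z : R => expR (- z) * A + expR z * B)); last first.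
  have /andP[ax xb] := axb.
  near=> z; apply: Lambda_inv2_gap => //; apply/andP; split.
    by near: z; exact: lt_nbhsr.
  by near: z; exact: lt_nbhsl.
have dN : is_derive x 1 (fun z : R => - z) (- 1) by exact: is_deriveN.
have dE := is_derive1_comp (is_derive_expR _) dN.
have dA : is_derive x 1 (fun z : R => expR (- z) * A) (- expR (- x) * A).
  rewrite (_ : (fun z => _) = A *: (expR \o (fun z : R => - z))); last first.
    by apply/funext => z; rewrite /= mulrC.
  by apply: (is_derive_eq (is_deriveZ _ dE)); rewrite /GRing.scale/=; ring.
have dB : is_derive x 1 (fun z : R => expR z * B) (expR x * B).
  rewrite (_ : (fun z => _) = B *: (@expR R)); last first.
    by apply/funext => z; rewrite /= mulrC.
  by apply: (is_derive_eq (is_deriveZ _ (is_derive_expR x))); rewrite /GRing.scale/=; ring.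
by have [_ ->] := is_deriveD dA dB.
Unshelve. all: by end_near. Qed.

(** The Green function is positive everywhere, so one zero of the convolution controls F on the
    whole line. *)
Lemma Lambda_inv2_eq0 F x : mu.-integrable setT (EFin \o F) -> (forall y, 0 <= F y) ->
  Lambda_inv2 F x = 0 -> {ae mu, forall y, F y = 0}.
Proof.
move=> Fi F0 L0.
have := @Rintegral_eq0_ae _ _ _ mu _ _ measurableT (integrable_green x _ Fi) _ L0.
move=> /(_ (fun y _ => mulr_ge0 (ltW (green_gt0 _)) (F0 y))).
apply: (@filterS _ _ (ae_filter_ringOfSetsType mu)).
by move=> y /(_ I) /eqP; rewrite mulf_eq0 gt_eqF ?green_gt0//= => /eqP.
Qed.

End GreenGap.

(** * Exponential moments of bumps and of their derivatives *)

Section BumpMoments.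
Context {R : realType}.
Local Notation mu := (@lebesgue_measure R).
Implicit Types (c r s x : R).

Lemma derivable_bumpf c r x : derivable (bumpf c r) x 1.
Proof. exact/derivable1_diffP/smooth_differentiable/smooth_bumpf. Qed.

Lemma continuous_bumpf c r : continuous (bumpf c r : R -> R).
Proof. exact: smooth_continuous (smooth_bumpf c r). Qed.

Lemma continuous_derive1_bumpf c r : continuous (derive1 (bumpf c r) : R -> R).
Proof.
rewrite (_ : derive1 _ = 'D_(1 : R^o) (bumpf c r : R^o -> R^o)).
  apply: smooth_continuous; apply: smooth_derive; exact: smooth_bumpf.
by apply/funext => x; rewrite derive1E.
Qed.

Lemma derive1_bumpf_out c r x : 0 < r -> ~ `[c - r, c + r]%classic x ->
  derive1 (bumpf c r) x = 0.
Proof.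
move=> r0 xcr; have tf := @bumpf_test_function R c r _ r0 (@subset_refl _ _).
by rewrite derive1E (@test_function_out _ _ _ _ _ (test_function_derive _ _ (1 : R^o) tf) xcr).
Qed.

Lemma integrable_continuous_segment (f : R -> R) a b : continuous f ->
  (forall x, ~ `[a, b]%classic x -> f x = 0) -> mu.-integrable setT (EFin \o f).
Proof.
move=> cf f0.
have fi : mu.-integrable `[a, b] (EFin \o f).
  apply: continuous_compact_integrable; first exact: segment_compact.
  exact: continuous_subspaceT.
have := (@integrable_mkcond _ _ _ mu _ (EFin \o f) (measurable_itv `[a, b])).1 fi.
rewrite (_ : _ \_ _ = EFin \o f)//.
apply/funext => x; rewrite /patch; case: ifPn => // /negP xab.
by rewrite /= f0// => xab'; apply: xab; rewrite inE.
Qed.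

Lemma continuous_expRM s : continuous (fun x : R => expR (s * x)).
Proof.
move=> x; apply: continuous_comp; last exact: continuous_expR.
exact: mulrl_continuous.
Qed.

Lemma integrable_derive1_bumpf c r s : 0 < r ->
  mu.-integrable setT (EFin \o (fun x => derive1 (bumpf c r) x * expR (s * x))).
Proof.
move=> r0; apply: (@integrable_continuous_segment _ (c - r) (c + r)).
  by move=> x; apply: continuousM; [exact: continuous_derive1_bumpf|exact: continuous_expRM].
by move=> x xcr; rewrite derive1_bumpf_out ?mul0r.
Qed.

Lemma integrable_bumpf_expR c r s : 0 < r ->
  mu.-integrable setT (EFin \o (fun x => bumpf c r x * expR (s * x))).
Proof.
move=> r0; apply: (@integrable_continuous_segment _ (c - r) (c + r)).
  by move=> x; apply: continuousM; [exact: continuous_bumpf|exact: continuous_expRM].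
by move=> x xcr; rewrite bumpf_out ?mul0r.
Qed.

(** Integration by parts on [c - r, c + r]; the boundary terms are zero because the bump vanishes at
    both ends. *)
Lemma Rintegral_derive1_bumpf c r s : 0 < r ->
  \int[mu]_x (derive1 (bumpf c r) x * expR (s * x)) =
  - s * \int[mu]_x (bumpf c r x * expR (s * x)).
Proof.
move=> r0; have cr : c - r < c + r by lra.
have mI : measurable (`[c - r, c + r]%classic : set R) by exact: measurable_itv.
rewrite [LHS](@Rintegral_subset _ _ _ mu `[c - r, c + r]%classic)//; last first.
  by move=> x _ xcr; rewrite derive1_bumpf_out ?mul0r.
rewrite [X in _ * X](@Rintegral_subset _ _ _ mu `[c - r, c + r]%classic)//; last first.
  by move=> x _ xcr; rewrite bumpf_out ?mul0r.
have e1 : bumpf c r (c + r) = 0 by rewrite bumpf_eq0// addrAC subrr add0r ler_norm.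
have e2 : bumpf c r (c - r) = 0.
  by rewrite bumpf_eq0// addrAC subrr add0r normrN ler_norm.
have dE x : is_derive x 1 (fun x : R => expR (s * x)) (s * expR (s * x)).
  have dM : is_derive x 1 (fun x : R => s * x) s.
    by apply: (is_derive_eq (is_deriveZ s (is_derive_id x 1))); rewrite /GRing.scale/= mulr1.
  by apply: (is_derive_eq (is_derive1_comp (is_derive_expR _) dM)); rewrite mulrC.
have csE : continuous (fun x : R => s * expR (s * x)).
  by move=> x; apply: cvgMl_tmp; exact: continuous_expRM.
have := @Rintegration_by_parts R (fun x => expR (s * x)) (bumpf c r)
  (fun x => s * expR (s * x)) (derive1 (bumpf c r)) _ _ cr.
rewrite e1 e2 !mulr0 subrr sub0r.
under eq_Rintegral do rewrite mulrC.
move=> ->; first last.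
- by [].
- split=> [x _||]; [exact: derivable_bumpf|apply: cvg_at_right_filter|apply: cvg_at_left_filter];
    exact: continuous_bumpf.
- apply: continuous_subspaceT; exact: continuous_derive1_bumpf.
- by move=> x _; rewrite derive1E; have [_ ->] := dE x.
- split=> [x _||]; [by have [] := dE x|apply: cvg_at_right_filter|apply: cvg_at_left_filter];
    exact: continuous_expRM.
- exact: continuous_subspaceT.
rewrite mulNr; congr (- _); rewrite -RintegralZl//.
  by apply: eq_Rintegral => x _; ring.
apply: (@integrableS _ _ _ mu setT) => //; exact: integrable_bumpf_expR.
Qed.

(** A zero integral would make the nonnegative integrand vanish almost everywhere, but it is
    positive on a ball. *)
Lemma Rintegral_bumpf_expR_gt0 c r s : 0 < r ->
  0 < \int[mu]_x (bumpf c r x * expR (s * x)).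
Proof.
move=> r0; rewrite lt0r Rintegral_ge0 ?andbT; last first.
  by move=> x _; rewrite mulr_ge0 ?bumpf_ge0// expR_ge0.
apply/negP => /eqP.
move=> /(@Rintegral_eq0_ae _ _ _ mu _ _ measurableT (integrable_bumpf_expR c r s r0)).
move=> /(_ (fun x _ => mulr_ge0 (bumpf_ge0 _ _ _) (expR_ge0 _))).
move=> /(ae_exists _ c r r0)[x]; rewrite /ball/= distrC => xr /(_ I) /eqP.
by rewrite gt_eqF// mulr_gt0 ?expR_gt0// bumpf_gt0.
Qed.

End BumpMoments.

(** * Energy densities and integrals depending on a parameter *)

Section H1Facts.
Context {R : realType}.
Local Notation mu := (@lebesgue_measure R).
Implicit Types (f df : R -> R).

(** The value k = 1 serves the energy and k = 1/2 the density of the non-local term. *)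
Lemma H1_integrable f df (k : R) : H1_function f df ->
  mu.-integrable setT (EFin \o (fun x => f x ^+ 2 + k * df x ^+ 2)).
Proof.
move=> [_ f2 df2 _].
have fi := Lfun2_integrable_sqr f2; have dfi := Lfun2_integrable_sqr df2.
exact: (@integrableD _ _ _ mu _ measurableT _ _ fi
  (@integrableZl _ _ _ mu _ measurableT k _ dfi)).
Qed.

Lemma H1_eq0 f df : H1_function f df ->
  {ae mu, forall x, f x ^+ 2 + df x ^+ 2 = 0} -> forall x, f x = 0.
Proof.
move=> [cf _ _ _] f0; apply: continuous_ae_eq0 => //.
move: f0; apply: (@filterS _ _ (ae_filter_ringOfSetsType mu)) => x /eqP.
by rewrite paddr_eq0 ?sqr_ge0// sqrf_eq0 => /andP[/eqP].
Qed.

(** Tonelli's theorem gives measurability of the extended real integral, and [fine] preserves it. *)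
Lemma measurable_Rintegral_param (G : R * R -> R) : measurable_fun setT G ->
  (forall p, 0 <= G p) -> measurable_fun setT (fun t => \int[mu]_y G (t, y)).
Proof.
move=> mG G0; apply: measurableT_comp; first exact: fine_measurable.
apply: (@measurable_fun_fubini_tonelli_F _ _ _ _ R mu (fun p => (G p)%:E)).
  exact/measurable_EFinP.
by move=> p; rewrite lee_fin.
Qed.

End H1Facts.

(** * Solutions vanishing on a rectangle *)

Section Slab.
Context {R : realType} (omega T : R) (u ux : R -> R -> R).
Context (u_sol : solution omega T u ux).
Context (energy_conserved : forall s t : R, 0 <= s < T -> 0 <= t < T ->
  energy u ux s = energy u ux t).
Local Notation mu := (@lebesgue_measure R).
Local Notation strip := (`]0, T[%classic `*` [set: R]).

(* Cut off outside the strip, since joint measurability of u and ux is only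
   known on it. *)
Definition slab_density : R * R -> R :=
  (fun p => u p.1 p.2 ^+ 2 + ux p.1 p.2 ^+ 2 / 2) \_ strip.

(** With [lweight] and [rweight] at the two ends of the interval, these are A(t) and B(t). *)
Definition slab_moment (w : R -> R) t := \int[mu]_y (w y * slab_density (t, y)).

Lemma slab_densityE t y : 0 < t < T ->
  slab_density (t, y) = u t y ^+ 2 + ux t y ^+ 2 / 2.
Proof.
by move=> tT; rewrite /slab_density /patch ifT// inE; split=> //=; rewrite in_itv.
Qed.

Lemma slab_density_ge0 p : 0 <= slab_density p.
Proof.
by rewrite /slab_density /patch; case: ifP => // _; rewrite addr_ge0 ?divr_ge0 ?sqr_ge0.
Qed.

Lemma measurable_slab_density : measurable_fun setT slab_density.
Proof.
have mS : measurable (strip : set (R * R)) by exact: measurableX.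
apply/(measurable_restrictT _ mS); apply: measurable_funD.
  by apply: measurable_funX; exact: solution_measurable u_sol.
by apply: measurable_funM => //; apply: measurable_funX; exact: solution_dx_measurable u_sol.
Qed.

Lemma integrable_density t : 0 <= t < T ->
  mu.-integrable setT (EFin \o (fun y => u t y ^+ 2 + ux t y ^+ 2 / 2)).
Proof.
move=> tT; have := H1_integrable _ _ (1 / 2) (solution_H1 u_sol tT).
by apply: eq_integrable => // y _ /=; rewrite mulrC mul1r.
Qed.

Lemma measurable_slab_moment (w : R -> R) : measurable_fun setT w -> (forall y, 0 <= w y) ->
  measurable_fun setT (slab_moment w).
Proof.
move=> mw w0; apply: (measurable_Rintegral_param (fun p => w p.2 * slab_density p)).
  apply: measurable_funM; last exact: measurable_slab_density.
  exact: (measurableT_comp mw measurable_snd).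
by move=> p; rewrite mulr_ge0 ?slab_density_ge0.
Qed.

Lemma slab_moment_ge0 (w : R -> R) t : (forall y, 0 <= w y) -> 0 <= slab_moment w t.
Proof. by move=> w0; rewrite Rintegral_ge0// => y _; rewrite mulr_ge0 ?slab_density_ge0. Qed.

(** The density is at most that of the energy, and the energy is conserved: the bound is uniform in
    t, which makes the moments integrable against bumps in time. *)
Lemma slab_moment_le (w : R -> R) C t : measurable_fun setT w -> (forall y, 0 <= w y <= C) ->
  slab_moment w t <= C * energy u ux 0.
Proof.
move=> mw wC.
have C0 : 0 <= C by have /andP[] := wC 0; exact: le_trans.
have E0 : 0 <= energy u ux 0 by rewrite Rintegral_ge0// => y _; rewrite addr_ge0 ?sqr_ge0.
(* At times outside (0, T) the cut-off makes the moment zero. *)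
have [tT|tT] := boolP (0 < t < T); last first.
  rewrite /slab_moment (_ : (fun y => _) = cst 0) ?Rintegral_cst// ?mul0r ?mulr_ge0//.
  apply/funext => y /=; rewrite /slab_density /patch ifF ?mulr0//.
  apply/negP; rewrite inE => -[/= +] _; rewrite in_itv/=; exact/negP.
have tT' : 0 <= t < T by case/andP: tT => /ltW -> ->.
have Tt : 0 <= (0 : R) < T by rewrite lexx; case/andP: tT; exact: lt_trans.
rewrite (energy_conserved _ _ Tt tT').
have di := integrable_density t tT'.
have ei := H1_integrable _ _ 1 (solution_H1 u_sol tT').
have {}ei : mu.-integrable setT (EFin \o (fun y => u t y ^+ 2 + ux t y ^+ 2)).
  by move: ei; apply: eq_integrable => // y _ /=; rewrite mul1r.
have wi := integrable_weight _ _ C mw wC di.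
rewrite /energy -RintegralZl// /slab_moment.
under eq_Rintegral do rewrite slab_densityE//.
apply: le_Rintegral => //; first exact: (@integrableZl _ _ _ mu _ measurableT C _ ei).
move=> y _; have /andP[w0 wy] := wC y.
have a0 := sqr_ge0 (u t y); have b0 := sqr_ge0 (ux t y).
by apply: ler_pM => //; [rewrite addr_ge0 ?divr_ge0|lra].
Qed.

Lemma integrable_bumpf_slab_moment (w : R -> R) C c r : 0 < r -> measurable_fun setT w ->
  (forall y, 0 <= w y <= C) ->
  mu.-integrable setT (EFin \o (fun t => slab_moment w t * bumpf c r t)).
Proof.
move=> r0 mw wC.
have w0 y : 0 <= w y by have /andP[] := wC y.
apply: (@integrable_bounded_mul _ _ _ mu _ _ _ (C * energy u ux 0)) => //.
- exact: measurable_slab_moment.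
- by move=> t _; rewrite ger0_norm ?slab_moment_ge0// slab_moment_le.
apply: (@integrable_continuous_segment _ _ (c - r) (c + r)).
  exact: continuous_bumpf.
by move=> x; exact: bumpf_out.
Qed.

End Slab.

(** * Vanishing of the moments and of the energy at some time *)

Section VanishingRectangle.
Context {R : realType} (omega T : R) (u ux : R -> R -> R) (t0 t1 x0 x1 : R).
Context (u_sol : solution omega T u ux).
Context (energy_conserved : forall s t : R, 0 <= s < T -> 0 <= t < T ->
  energy u ux s = energy u ux t).
Context (t0_gt0 : 0 < t0) (t01 : t0 < t1) (t1_ltT : t1 < T) (x01 : x0 < x1).
Context (u_eq0 : forall t x : R, t0 < t < t1 -> x0 < x < x1 -> u t x = 0).
Local Notation mu := (@lebesgue_measure R).
Local Notation strip := (`]0, T[%classic `*` [set: R]).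
Local Notation rect := (`]t0, t1[%classic `*` `]x0, x1[%classic).
Local Notation moment := (slab_moment T u ux).

Let strip_time t : t0 < t < t1 -> 0 < t < T.
Proof.
by move=> /andP[t0t tt1]; rewrite (lt_trans t0_gt0 t0t) (lt_trans tt1 t1_ltT).
Qed.

Let strip_time_le t : t0 < t < t1 -> 0 <= t < T.
Proof. by move=> /strip_time/andP[/ltW -> ->]. Qed.

Let rect_strip : rect `<=` strip.
Proof. by move=> p [/= p1 _]; split=> //=; move: p1; rewrite !in_itv/=; exact: strip_time. Qed.

Lemma ux_eq0_ae t : t0 < t < t1 -> {ae mu, forall x, x0 < x < x1 -> ux t x = 0}.
Proof.
move=> tt; have [_ _ ux2 wd] := solution_H1 u_sol (strip_time_le _ tt).
apply: (weak_derivative_eq0 _ _ _ _ wd (Lfun2_locally_integrable _ ux2)) => x.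
exact: u_eq0.
Qed.

Lemma density_eq0_ae t : t0 < t < t1 ->
  {ae mu, forall x, x0 < x < x1 -> u t x ^+ 2 + ux t x ^+ 2 / 2 = 0}.
Proof.
move=> tt; move: (ux_eq0_ae t tt); apply: (@filterS _ _ (ae_filter_ringOfSetsType mu)).
by move=> x ux0 xx; rewrite ux0// u_eq0// expr0n/= mul0r addr0.
Qed.

Lemma momentE (w : R -> R) t : t0 < t < t1 ->
  moment w t = \int[mu]_y (w y * (u t y ^+ 2 + ux t y ^+ 2 / 2)).
Proof.
move=> tt; rewrite /slab_moment; apply: eq_Rintegral => y _.
by rewrite slab_densityE// strip_time.
Qed.

Lemma nonlocalE t x : t0 < t < t1 -> x0 < x < x1 ->
  nonlocal u ux t x =
  - expR (- x) * moment (lweight x0) t + expR x * moment (rweight x1) t.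
Proof.
move=> tt xx; rewrite !momentE//; apply: (derive1_Lambda_inv2_gap _ x0 x1) => //.
  exact: integrable_density u_sol t (strip_time_le _ tt).
exact: density_eq0_ae.
Qed.

(** The integrand can be nonzero only in the rectangle and where [ux] is nonzero, a set all of whose
    time sections are null. *)
Lemma Rintegral_ux_eq0 (phi : R^o * R^o -> R^o) :
  measurable_fun setT (phi : R * R -> R) -> (forall p, ~ rect p -> phi p = 0) ->
  \int[(mu \x mu)%E]_(p in strip) (2 * omega * ux p.1 p.2 * phi p) = 0.
Proof.
move=> mphi phi0.
have mS : measurable (strip : set (R * R)) by exact: measurableX.
have mg : measurable_fun strip (fun p : R * R => 2 * omega * ux p.1 p.2 * phi p).
  apply: measurable_funM; last exact: measurable_funTS.
  by apply: measurable_funM => //; exact: solution_dx_measurable u_sol.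
(* The null sets obtained at different times are unrelated, so measurability in the plane is taken
   from the integrand itself. *)
pose Z : set (R * R) := strip `&` (fun p => 2 * omega * ux p.1 p.2 * phi p) @^-1` (~` [set 0]).
have mZ : measurable Z by apply: mg => //; exact: measurableC.
have Z0 : (mu \x mu)%E Z = 0%E.
  apply: null_xsection => // t.
  have Zrect x : Z (t, x) -> rect (t, x) /\ ux t x <> 0.
    move=> [_ /= Zx]; split.
      by apply: contrapT => np; apply: Zx; rewrite (phi0 (t, x) np) mulr0.
    by move=> ux0; apply: Zx; rewrite ux0 mulr0 mul0r.
  have [tt|tt] := boolP (t0 < t < t1); last first.
    rewrite (_ : xsection Z t = set0) ?measure0// -subset0 => x; rewrite /xsection/= inE.
    by move=> /Zrect[[/= + _] _]; rewrite in_itv/= (negbTE tt).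
  have [N [mN N0 uxN]] := ux_eq0_ae t tt.
  apply: (@subset_measure0 _ _ _ mu _ N) => //; first exact: measurable_xsection.
  move=> x; rewrite /xsection/= inE => /Zrect[[/= _ xx] uxx]; apply: uxN => /= ux0.
  by apply/uxx/ux0; move: xx; rewrite in_itv.
rewrite (@ae_eq_Rintegral _ _ _ (mu \x mu)%E strip _ (cst 0))// ?Rintegral_cst ?mul0r//.
exists Z; split=> // p /= np; split; first by apply: contrapT => Sp; apply: np => /Sp.
by move=> /= p0; apply: np => _.
Qed.

(** The factors [- - 1] and [- 1] are the [- s] produced by [Rintegral_derive1_bumpf] for s = -1 and
    s = 1. *)
Let pos_comb_eq0 (a b p q : R) : 0 <= a -> 0 <= b -> 0 < p -> 0 < q ->
  0 = a * (- - 1 * p) - b * (- 1 * q) -> a = 0 /\ b = 0.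
Proof.
rewrite opprK mul1r mulN1r mulrN opprK => a0 b0 p0 q0 /esym/eqP.
rewrite paddr_eq0 ?mulr_ge0 ?(ltW p0) ?(ltW q0)//.
by rewrite !mulf_eq0 (gt_eqF p0) (gt_eqF q0) !orbF => /andP[/eqP -> /eqP ->].
Qed.

(* Tested against a(t) b'(x), the non-local term acquires a sign after an
   integration by parts in x. *)
Lemma exists_moment_eq0 : exists2 t, t0 < t < t1 &
  moment (lweight x0) t = 0 /\ moment (rweight x1) t = 0.
Proof.
have ringE (a b m n e1 e2 : R) :
    a * b * (m * e1 - n * e2) = m * a * (b * e1) - n * a * (b * e2) by ring.
have ringF (a e1 e2 m n : R) :
    - (- e1 * m + e2 * n) * a = a * (m * e1 - n * e2) by ring.
have tlt := t01; have xlt := x01.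
(* Centres at the midpoints and radii a quarter of the sides keep the closed supports inside the
   open rectangle. *)
pose c := (t0 + t1) / 2; pose r := (t1 - t0) / 4.
pose c' := (x0 + x1) / 2; pose r' := (x1 - x0) / 4.
have r0 : 0 < r by rewrite divr_gt0// subr_gt0.
have r'0 : 0 < r' by rewrite divr_gt0// subr_gt0.
have ball_time t : ball c r t -> t0 < t < t1.
  by rewrite /ball/= ltr_distlC /c /r => /andP[? ?]; apply/andP; split; lra.
pose phi : R^o * R^o -> R^o := 'D_(0, 1) (bumpf2 c r c' r').
have phiE p : phi p = bumpf c r p.1 * derive1 (bumpf c' r') p.2 by exact: derive_bumpf2.
have tphi : test_function (rect : set (R^o * R^o)) phi.
  apply/test_function_derive/bumpf2_test_function => // p [/= p1 p2].
  split=> /=; [move: p1|move: p2]; rewrite !in_itv/= /c /r /c' /r' => /andP[? ?];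
    by apply/andP; split; lra.
have phi0 p : ~ rect p -> phi p = 0 by exact: test_function_out tphi.
have mphi : measurable_fun setT (phi : R * R -> R).
  rewrite (_ : phi = (fun p => bumpf c r p.1 * derive1 (bumpf c' r') p.2)).
    apply: measurable_tensor; first exact: measurable_bumpf.
    apply: continuous_measurable_fun; exact: continuous_derive1_bumpf.
  by apply/funext => p; exact: phiE.
have := solution_eq u_sol (test_function_sub _ _ _ rect_strip tphi).
(* On the rectangle u = 0, and outside it [phi] and its t-derivative vanish; only the term in 2
   omega remains on the left. *)
rewrite (@eq_Rintegral _ _ _ (mu \x mu)%E strip
  (fun p => 2 * omega * ux p.1 p.2 * phi p)); last first.
  move=> p _; have [rp|rp] := pselect (rect p); last first.
    have tD := test_function_derive _ _ ((1, 0) : R^o * R^o) tphi.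
    rewrite phi0// (test_function_out _ _ _ tD rp).
    by rewrite !mulr0 oppr0 addr0.
  rewrite u_eq0; first by rewrite mul0r oppr0 add0r add0r.
    by case: rp => /=; rewrite in_itv.
  by case: rp => /= _; rewrite in_itv.
rewrite Rintegral_ux_eq0//.
pose A t := moment (lweight x0) t * bumpf c r t.
pose B t := moment (rweight x1) t * bumpf c r t.
pose p s x := derive1 (bumpf c' r') x * expR (s * x).
have Ai : mu.-integrable setT (EFin \o A).
  apply: (integrable_bumpf_slab_moment _ _ _ _ u_sol energy_conserved _ (expR x0 / 2)) => //.
    exact: measurable_lweight.
  by move=> y; rewrite lweight_ge0 lweight_le.
have Bi : mu.-integrable setT (EFin \o B).
  apply: (integrable_bumpf_slab_moment _ _ _ _ u_sol energy_conserved _ (expR (- x1) / 2)) => //.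
    exact: measurable_rweight.
  by move=> y; rewrite rweight_ge0 rweight_le.
have pi s : mu.-integrable setT (EFin \o p s) by exact: integrable_derive1_bumpf.
have mS : measurable (strip : set (R * R)) by exact: measurableX.
(* On the rectangle the gap formula separates the variables; outside it both sides carry the factor
   [phi] = 0. *)
have AB q : - nonlocal u ux q.1 q.2 * phi q = A q.1 * p (- 1) q.2 - B q.1 * p 1 q.2.
  rewrite /A /B /p -ringE -phiE.
  have [rq|rq] := pselect (rect q); last by rewrite phi0// mulr0 mul0r.
  rewrite nonlocalE; last 2 first.
    by case: rq => /=; rewrite in_itv.
    by case: rq => /= _; rewrite in_itv.
  by rewrite ringF mulN1r mul1r.
rewrite (@eq_Rintegral _ _ _ (mu \x mu)%E strip
  (fun q => A q.1 * p (- 1) q.2 - B q.1 * p 1 q.2) _ (fun q _ => AB q)).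
(* The product formula for integrals is on the whole plane, and the integrand vanishes outside the
   strip. *)
rewrite -(@Rintegral_subset _ _ _ (mu \x mu)%E strip setT)//; last first.
  by move=> q _ nq; rewrite -AB phi0 ?mulr0// => /rect_strip.
rewrite (@RintegralB _ _ _ (mu \x mu)%E setT
  (fun q => A q.1 * p (- 1) q.2) (fun q => B q.1 * p 1 q.2) measurableT
  (integrable_tensor _ _ Ai (pi _)) (integrable_tensor _ _ Bi (pi _))).
rewrite (Rintegral_tensor _ _ Ai (pi _)) (Rintegral_tensor _ _ Bi (pi _)).
(* The signs from s = -1 and s = 1 turn the difference into a sum of nonnegative terms equal to
   0. *)
rewrite (Rintegral_derive1_bumpf c' r' (- 1) r'0) (Rintegral_derive1_bumpf c' r' 1 r'0) => e.
have A0 t : 0 <= A t.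
  by rewrite mulr_ge0 ?bumpf_ge0// slab_moment_ge0// => y; exact: lweight_ge0.
have B0 t : 0 <= B t.
  by rewrite mulr_ge0 ?bumpf_ge0// slab_moment_ge0// => y; exact: rweight_ge0.
have [IA IB] := pos_comb_eq0 _ _ _ _ (Rintegral_ge0 mu (fun t _ => A0 t))
  (Rintegral_ge0 mu (fun t _ => B0 t)) (Rintegral_bumpf_expR_gt0 c' r' (- 1) r'0)
  (Rintegral_bumpf_expR_gt0 c' r' 1 r'0) e.
have aeA := @Rintegral_eq0_ae _ _ _ mu _ _ measurableT Ai (fun t _ => A0 t) IA.
have aeB := @Rintegral_eq0_ae _ _ _ mu _ _ measurableT Bi (fun t _ => B0 t) IB.
(* Both products vanish at almost every time, hence at a common time in the ball, where the bump is
   positive and can be cancelled. *)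
have aeAB := @filterI _ _ (ae_filter_ringOfSetsType mu) _ _ aeA aeB.
have [t ct [/(_ I) At /(_ I) Bt]] := ae_exists _ c r r0 aeAB.
have bt : bumpf c r t != 0 by rewrite gt_eqF// bumpf_gt0// distrC.
exists t; first exact: ball_time.
split.
- by move/eqP: At; rewrite mulf_eq0 (negbTE bt) orbF => /eqP.
- by move/eqP: Bt; rewrite mulf_eq0 (negbTE bt) orbF => /eqP.
Qed.

Lemma exists_energy_eq0 : exists2 t, 0 <= t < T & energy u ux t = 0.
Proof.
have xm : x0 < (x0 + x1) / 2 < x1 by have := x01; lra.
have sum0 (a b : R) : 0 <= a -> 0 <= b -> a + b / 2 = 0 -> a + b = 0 by lra.
have [t tt [A0 B0]] := exists_moment_eq0.
have tT := strip_time_le _ tt; exists t => //.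
have di := integrable_density _ _ _ _ u_sol t tT.
(* At the midpoint, a point of the gap, the convolution is a combination of the two moments, both
   zero at time t. *)
have L0 : Lambda_inv2 (fun y => u t y ^+ 2 + ux t y ^+ 2 / 2) ((x0 + x1) / 2) = 0.
  rewrite (Lambda_inv2_gap _ x0 x1 _ di (density_eq0_ae t tt) xm).
  by rewrite -!momentE// A0 B0 !mulr0 addr0.
have d_ge0 y : 0 <= u t y ^+ 2 + ux t y ^+ 2 / 2.
  by rewrite addr_ge0 ?divr_ge0 ?sqr_ge0.
have d0 := Lambda_inv2_eq0 _ _ di d_ge0 L0.
rewrite /energy (@ae_eq_Rintegral _ _ _ mu setT _ (cst 0))// ?Rintegral_cst ?mul0r//.
  have := H1_integrable _ _ 1 (solution_H1 u_sol tT).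
  move=> /(measurable_int mu)/measurable_EFinP; apply: eq_measurable_fun => y _.
  by rewrite mul1r.
move: d0; apply: (@filterS _ _ (ae_filter_ringOfSetsType mu)) => y + _ /=.
by apply: sum0; exact: sqr_ge0.
Qed.

End VanishingRectangle.

(** * From zero energy at one time to the vanishing of the solution *)

Theorem theorem7p2 (R : realType) (omega T : R) (u ux : R -> R -> R)
  (T_gt0 : 0 < T)
  (u_sol : solution omega T u ux)
  (energy_conserved : forall s t : R, 0 <= s < T -> 0 <= t < T ->
     energy u ux s = energy u ux t)
  (nonlocal_C1 : forall t : R, 0 <= t < T -> C1 (nonlocal u ux t))
  (u_vanishes : exists t0 t1 x0 x1 : R,
     [/\ 0 < t0, t0 < t1, t1 < T, x0 < x1
       & forall t x : R, t0 < t < t1 -> x0 < x < x1 -> u t x = 0]) :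
  forall t x : R, 0 <= t < T -> u t x = 0.
Proof.
have [t0 [t1 [x0 [x1 [t0_gt0 t01 t1T x01 u0]]]]] := u_vanishes.
have [s sT Es] := exists_energy_eq0 _ _ _ _ _ _ _ _ u_sol energy_conserved
  t0_gt0 t01 t1T x01 u0.
move=> t x tT; have H1 := solution_H1 u_sol tT.
(* Continuity of u(t, .) reduces the claim at every x to the vanishing of the energy density almost
   everywhere. *)
apply: (H1_eq0 _ _ H1).
have ei := H1_integrable _ _ 1 H1.
have {}ei : lebesgue_measure.-integrable setT (EFin \o (fun y => u t y ^+ 2 + ux t y ^+ 2)).
  by move: ei; apply: eq_integrable => // y _ /=; rewrite mul1r.
have Et : energy u ux t = 0 by rewrite (energy_conserved _ _ tT sT).
have := @Rintegral_eq0_ae _ _ _ lebesgue_measure _ _ measurableT ei _ Et.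
move=> /(_ (fun y _ => addr_ge0 (sqr_ge0 _) (sqr_ge0 _))).
by apply: (@filterS _ _ (ae_filter_ringOfSetsType lebesgue_measure)) => y /(_ I).
Qed.
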